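(* Let $n$ be a positive integer and let $k\ge 3$ be an integer. If $F_n\equiv F_{n+1}\equiv 1\pmod k$, then the equation $$F_nx+F_{n+1}y=\frac{(F_n-1)(F_{n+1}-1)}{k}$$ has the unique nonnegative integral solution $$x=\frac{F_n-1}{k}\quad\text{and}\quad y=\frac{F_{n-2}-1}{k}.$$
   Context: $(F_n)$ is the Fibonacci sequence with $F_1=F_2=1$ and $F_n=F_{n-1}+F_{n-2}$ for all $n\in\mathbb{Z}$ (so $F_0=0$, $F_{-1}=1$). *)

(* Defs.v *)
From mathcomp Require Import all_boot all_order all_algebra.
From mathcomp Require Import ring.

Set Implicit Arguments.
Unset Strict Implicit.
Unset Printing Implicit Defensive.

Import Order.TTheory GRing.Theory Num.Theory.
Local Open Scope ring_scope.

(* The pair (F_i, F_{i+1}) is moved one index up or down by the Fibonacci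
   recurrence; both directions start from (F_0, F_1) = (0, 1). *)
Definition fib_up (p : int * int) : int * int := (p.2, p.1 + p.2).
Definition fib_down (p : int * int) : int * int := (p.2 - p.1, p.1).

Definition fib (n : int) : int :=
  match n with
  | Posz m => (iter m fib_up (0, 1)).1
  | Negz m => (iter m.+1 fib_down (0, 1)).1
  end.

Lemma fib1 : fib 1 = 1. Proof. by []. Qed.

Lemma fib2 : fib 2 = 1. Proof. by []. Qed.

Lemma fib_rec (n : int) : fib n = fib (n - 1) + fib (n - 2).
Proof.
case: n => [[|[|m]]|m] //.
- have -> : Posz m.+2 - 1 = Posz m.+1 by rewrite -addn1 PoszD addrK.
  have -> : Posz m.+2 - 2 = Posz m by rewrite -addn2 PoszD addrK.
  by rewrite /= addrC.
- have -> : Negz m - 1 = Negz m.+1 by rewrite !NegzE -opprD -PoszD addn1.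
  have -> : Negz m - 2 = Negz m.+2 by rewrite !NegzE -opprD -PoszD addn2.
  rewrite /fib !iterS; set p := iter m _ _; rewrite /fib_down /=; ring.
Qed.

Lemma fib_unique (f : int -> int) :
    f 1 = 1 -> f 2 = 1 -> (forall n, f n = f (n - 1) + f (n - 2)) ->
  forall n, f n = fib n.
Proof.
move=> f1 f2 frec.
have f0 : f 0 = 0.
  have e : f 2 = f 1 + f 0 by exact: (frec 2).
  by apply: (@addrI _ (f 1)); rewrite -e f1 f2.
have up m : iter m fib_up (0, 1) = (f (Posz m), f (Posz m.+1)).
  elim: m => [|m IHm]; first by rewrite f0 f1.
  rewrite iterS IHm /fib_up /= [in RHS](frec (Posz m.+2)).
  have -> : Posz m.+2 - 1 = Posz m.+1 by rewrite -addn1 PoszD addrK.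
  have -> : Posz m.+2 - 2 = Posz m by rewrite -addn2 PoszD addrK.
  by rewrite addrC.
have down m : iter m fib_down (0, 1) = (f (- Posz m), f (1 - Posz m)).
  elim: m => [|m IHm]; first by rewrite oppr0 addr0 f0 f1.
  have e1 : 1 - Posz m.+1 = - Posz m by rewrite (intS m); ring.
  have e2 : 1 - Posz m - 2 = - Posz m.+1 by rewrite (intS m); ring.
  have e3 : 1 - Posz m - 1 = - Posz m by ring.
  by rewrite iterS IHm /fib_down /= e1 (frec (1 - Posz m)) e2 e3 addrAC subrr add0r.
by case=> m; rewrite /fib ?up // down NegzE.
Qed.

(* Main.v *)
Require Import Defs.
From mathcomp Require Import all_boot all_order all_algebra.
From mathcomp Require Import zify ring.
Import Order.TTheory GRing.Theory Num.Theory.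
Local Open Scope ring_scope.

(** Write a = F_n and b = F_(n+1), so that F_(n-2) = 2 a - b and
    1 <= a <= b <= 2 a.  Cassini's identity says a (a + b) - b^2 = 1 or -1,
    according to whether n is odd or even.  Reducing it modulo k, where
    a = b = 1, gives 1 = 1 or 1 = -1; the latter is impossible since k >= 3,
    so the value is 1 ([cassini_sign]).  Now put a = 1 + k u and b = 1 + k v.
    The proposed solution is (u, 2 u - v), and the equation
    a u + b (2 u - v) = k u v it has to satisfy is, up to the factor k,
    exactly Cassini's identity with value 1.

    The same identity is a Bezout relation between a and b, so two solutions
    differ by a multiple t of (b, - a).  Since 0 <= u < b and
    0 <= 2 u - v < a, only t = 0 keeps both coordinates nonnegative
    ([nonneg_solution_unique]). *)

Lemma fibSS (m : nat) : fib m.+2 = fib m + fib m.+1.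
Proof. by []. Qed.

Lemma fib_cassini (m : nat) :
  fib m.+1 * (fib m.+1 + fib m.+2) - fib m.+2 * fib m.+2 = (-1) ^+ m.
Proof.
elim: m => [//|m IHm]; rewrite exprS -IHm (fibSS m.+1); ring.
Qed.

Lemma fib_growth (m : nat) :
  [/\ 1 <= fib m.+1, fib m.+1 <= fib m.+2 & fib m.+2 <= 2 * fib m.+1].
Proof.
elim: m => [//|m [h1 h2 h3]]; rewrite (fibSS m.+1).
move: (fib m.+1) (fib m.+2) h1 h2 h3 => a b h1 h2 h3; split; lia.
Qed.

Lemma fib_sub2 (n : int) : fib (n - 2) = 2 * fib n - fib (n + 1).
Proof.
have := fib_rec n; have := fib_rec (n + 1).
have -> : n + 1 - 1 = n by ring.
have -> : n + 1 - 2 = n - 1 by ring.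
move=> -> ->; ring.
Qed.

Lemma eq1_modz (k a : int) : (a = 1 %[mod k])%Z -> exists u : int, a = 1 + k * u.
Proof.
move/eqP; rewrite eqz_mod_dvd => /dvdzP [u hu].
by exists u; rewrite mulrC -hu; ring.
Qed.

Lemma quotient_bounds (k w : int) :
  1 < k -> 0 <= 1 + k * w -> 0 <= w /\ w < 1 + k * w.
Proof. by move=> hk h; split; nia. Qed.

(** If a = b = 1 modulo k >= 3, then a (a + b) - b^2 = 1 modulo k, and a sign
    congruent to 1 modulo k is 1. *)
Lemma cassini_sign (k u v a b : int) (m : nat) :
    a = 1 + k * u -> b = 1 + k * v -> 3 <= k ->
    a * (a + b) - b * b = (-1) ^+ m ->
  a * (a + b) - b * b = 1.
Proof.
move=> ha hb hk; rewrite -signr_odd; case: (odd m) => //=; rewrite expr1 => h.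
exfalso.
set w := 3 * u - v + k * (u * u + u * v - v * v).
have : k * w + 2 = 0 by move: h; rewrite ha hb /w; lia.
by case: (lerP 0 w) => hw; nia.
Qed.

(** The Cassini relation a (a + b) - b^2 = 1 makes a and b coprime, and the
    bounds x < b and y < a leave no room to move by a multiple of (b, - a). *)
Lemma nonneg_solution_unique (a b x y x' y' : int) :
    a * (a + b) - b * b = 1 -> 0 < a -> 0 < b ->
    x < b -> y < a -> 0 <= x' -> 0 <= y' ->
    a * x' + b * y' = a * x + b * y ->
  x' = x /\ y' = y.
Proof.
move=> hC ha hb hx hy hx' hy' E.
(* the multiplier t in (x', y') = (x, y) + t (b, - a), solved for by Bezout *)
pose t := (a + b) * (y - y') - b * (x' - x).
have E' : b * (y - y') = a * (x' - x) by move: E; lia.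
have tx : x' - x = b * t.
  have -> : b * t = (a + b) * (b * (y - y')) - b * b * (x' - x) by rewrite /t; ring.
  by rewrite E' -[LHS]mul1r -hC; ring.
have ty : y - y' = a * t.
  have -> : a * t = a * (a + b) * (y - y') - b * (a * (x' - x)) by rewrite /t; ring.
  by rewrite -E' -[LHS]mul1r -hC; ring.
have t0 : t = 0.
  move: t tx ty => t tx ty; clear -ha hb hx hy hx' hy' tx ty.
  by case: (ltrgtP t 0) => // ht; exfalso; nia.
by move: tx ty; rewrite t0; lia.
Qed.

Theorem proposition3p2 (n k : int) (hn : 0 < n) (hk : 3 <= k)
    (hFn : (fib n = fib (n + 1) %[mod k])%Z)
    (hFn1 : (fib (n + 1) = 1 %[mod k])%Z) :
  exists x y : int,
    [/\ x%:Q = ((fib n)%:Q - 1) / k%:Q,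
        y%:Q = ((fib (n - 2))%:Q - 1) / k%:Q
      & forall x' y' : int,
          [/\ 0 <= x', 0 <= y'
            & (fib n)%:Q * x'%:Q + (fib (n + 1))%:Q * y'%:Q =
              ((fib n)%:Q - 1) * ((fib (n + 1))%:Q - 1) / k%:Q]
          <-> x' = x /\ y' = y].
Proof.
rewrite fib_sub2.
case: n hn hFn hFn1 => [[//|m]|//] _ hab hb1.
have ha1 := etrans hab hb1.
move: ha1 hb1 {hab}; have -> : Posz m.+1 + 1 = m.+2 by rewrite -PoszD addn1.
have := fib_growth m; have := fib_cassini m.
move: (fib m.+1) (fib m.+2) => a b hC [a1 ab b2a].
move=> /eq1_modz [u ha] /eq1_modz [v hb].
have {}hC := cassini_sign _ _ _ _ _ _ ha hb hk hC.
have k0 : k%:Q != 0 by rewrite intr_eq0; lia.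
have ec : 2 * a - b = 1 + k * (2 * u - v) by rewrite ha hb; ring.
have [u0 hx] : 0 <= u /\ u < a by rewrite ha; apply: quotient_bounds => //; lia.
have [y0 hy] : 0 <= 2 * u - v /\ 2 * u - v < 2 * a - b.
  by rewrite ec; apply: quotient_bounds => //; lia.
(* k times the equation for (u, 2 u - v) is the Cassini relation *)
have sol : a * u + b * (2 * u - v) = k * u * v.
  have kI : k != 0 by lia.
  apply: (mulfI kI); move: hC; rewrite ha hb => hC.
  lia.
have rhs : (a%:Q - 1) * (b%:Q - 1) / k%:Q = (k * u * v)%:Q.
  by rewrite ha hb !(rmorphD, rmorphM) /=; field.
exists u, (2 * u - v); split.
- by rewrite ha !(rmorphD, rmorphM) /=; field.
- by rewrite ha hb !(rmorphD, rmorphB, rmorphM) /=; field.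
move=> x' y'; rewrite rhs -!intrM -intrD; split.
  case=> hx' hy' /intr_inj; rewrite -sol.
  by apply: nonneg_solution_unique => //; lia.
by case=> -> ->; rewrite sol.
Qed.
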